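(* For every monoidal signature $T$, the category $\mathbf{SGraph}_T$ of string graphs over $T$ is a partial adhesive category, via its full embedding $S:\mathbf{SGraph}_T\to\mathbf{Graph}/G_T$ (that is, $\mathbf{Graph}/G_T$ is adhesive and $S$ preserves monomorphisms).
   Context: A category is adhesive if it has pullbacks and pushouts along monomorphisms, and pushouts along monomorphisms are van Kampen squares. A category $\mathcal C$ is partial adhesive if it is a full subcategory of an adhesive category $\mathcal A$ and the embedding functor $S:\mathcal C\to\mathcal A$ preserves monomorphisms. $\mathbf{Graph}$ is the category of directed multigraphs $(V,E,s,t)$. A monoidal signature $T=(O,M,\mathrm{dom},\mathrm{cod})$ consists of sets $O,M$ and functions $\mathrm{dom},\mathrm{cod}:M\to w(O)$, where $w(O)$ is the set of finite lists over $O$. The derived typegraph $G_T$ has vertex set $O+M$ and edges: a self-loop $\mathrm{mid}_X$ at each $X\in O$; for $f\in M$ an edge $\mathrm{in}_{f,i}$ from $\mathrm{dom}(f)[i]$ to $f$ for each position $i$ of $\mathrm{dom}(f)$, and an edge $\mathrm{out}_{f,j}$ from $f$ to $\mathrm{cod}(f)[j]$ for each position $j$ of $\mathrm{cod}(f)$. For an object $(G,\tau:G\to G_T)$ of the slice category $\mathbf{Graph}/G_T$, a vertex $v$ is a wire-vertex if $\tau(v)\in O$ and a box-vertex if $\tau(v)\in M$; $N(v)=s^{-1}(v)\cup t^{-1}(v)$ is the set of edges incident to $v$. $(G,\tau)$ is a string graph if every wire-vertex has at most one in-edge and at most one out-edge, and for each box-vertex $b$ the map $N(b)\to N(\tau(b))$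 induced by $\tau$ is a bijection. $\mathbf{SGraph}_T$ is the full subcategory of $\mathbf{Graph}/G_T$ whose objects are string graphs. *)

(* Defs.v *)
(* Homs are compared with Leibniz equality; morphisms that carry proofs are
   identified by proof irrelevance, taken from boolp. *)
From mathcomp Require Import all_boot.
From mathcomp Require Import boolp.

Set Implicit Arguments.
Unset Strict Implicit.
Unset Printing Implicit Defensive.

Record category := Category {
  obj :> Type;
  hom : obj -> obj -> Type;
  idm : forall X, hom X X;
  compm : forall X Y Z, hom Y Z -> hom X Y -> hom X Z;
  compm1 : forall X Y (f : hom X Y), compm f (idm X) = f;
  comp1m : forall X Y (f : hom X Y), compm (idm Y) f = f;
  compmA : forall X Y Z W (h : hom Z W) (g : hom Y Z) (f : hom X Y),
    compm h (compm g f) = compm (compm h g) f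
}.

Arguments hom {c} X Y.
Arguments idm {c} X.
Arguments compm {c X Y Z} g f.

Notation "g '∘' f" := (compm g f) (at level 40, left associativity).

Record functor (C D : category) := Functor {
  fobj :> C -> D;
  fmap : forall X Y : C, hom X Y -> hom (fobj X) (fobj Y);
  fmap_id : forall X : C, fmap (idm X) = idm (fobj X);
  fmap_comp : forall (X Y Z : C) (g : hom Y Z) (f : hom X Y),
    fmap (g ∘ f) = fmap g ∘ fmap f
}.

Section Notions.
Variable C : category.

Definition mono (X Y : C) (m : hom X Y) : Prop :=
  forall (Z : C) (f g : hom Z X), m ∘ f = m ∘ g -> f = g.

(*    P --q--> B
      |p       |g
      A --f--> Z    *)
Definition is_pullback (P A B Z : C) (p : hom P A) (q : hom P B)
    (f : hom A Z) (g : hom B Z) : Prop :=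
  f ∘ p = g ∘ q /\
  forall (W : C) (a : hom W A) (b : hom W B), f ∘ a = g ∘ b ->
    exists! u : hom W P, p ∘ u = a /\ q ∘ u = b.

(*    Z --g--> B
      |f       |k
      A --h--> Q    *)
Definition is_pushout (Z A B Q : C) (f : hom Z A) (g : hom Z B)
    (h : hom A Q) (k : hom B Q) : Prop :=
  h ∘ f = k ∘ g /\
  forall (W : C) (a : hom A W) (b : hom B W), a ∘ f = b ∘ g ->
    exists! u : hom Q W, u ∘ h = a /\ u ∘ k = b.

(* The pushout square (f, g, h, k) is the bottom face of the cubes considered,
   (f', g', h', k') is the top face and z, a, b, q are the vertical edges,
   pointing downwards. The back faces are those over f and g, the front faces
   those over h and k. *)
Definition van_kampen (Z A B Q : C) (f : hom Z A) (g : hom Z B)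
    (h : hom A Q) (k : hom B Q) : Prop :=
  is_pushout f g h k /\
  forall (Z' A' B' Q' : C) (f' : hom Z' A') (g' : hom Z' B')
    (h' : hom A' Q') (k' : hom B' Q')
    (z : hom Z' Z) (a : hom A' A) (b : hom B' B) (q : hom Q' Q),
    h' ∘ f' = k' ∘ g' -> q ∘ h' = h ∘ a -> q ∘ k' = k ∘ b ->
    is_pullback f' z a f -> is_pullback g' z b g ->
    (is_pushout f' g' h' k' <-> is_pullback h' a q h /\ is_pullback k' b q k).

Definition has_pullbacks : Prop :=
  forall (A B Z : C) (f : hom A Z) (g : hom B Z),
  exists (P : C) (p : hom P A) (q : hom P B), is_pullback p q f g.

(* In a pushout along a monomorphism, one leg of the span is mono and the
   other leg is arbitrary. *)
Definition has_pushouts_along_monos : Prop :=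
  forall (Z A B : C) (m : hom Z A) (g : hom Z B), mono m ->
  exists (Q : C) (h : hom A Q) (k : hom B Q), is_pushout m g h k.

Definition adhesive : Prop :=
  [/\ has_pullbacks,
      has_pushouts_along_monos &
      forall (Z A B Q : C) (m : hom Z A) (g : hom Z B)
        (h : hom A Q) (k : hom B Q),
        mono m -> is_pushout m g h k -> van_kampen m g h k].

End Notions.

Definition preserves_monos (C D : category) (S : functor C D) : Prop :=
  forall (X Y : C) (m : hom X Y), mono m -> mono (fmap S m).

Definition full_embedding (C D : category) (S : functor C D) : Prop :=
  injective S /\ forall X Y : C, bijective (@fmap C D S X Y).

Definition partial_adhesive_via (C A : category) (S : functor C A) : Prop :=
  [/\ full_embedding S, adhesive A & preserves_monos S].

Definition full_subcategory (C : category) (P : C -> Prop) : category :=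
  @Category {X : C | P X} (fun X Y => hom (sval X) (sval Y))
    (fun X => idm (sval X)) (fun X Y Z g f => g ∘ f)
    (fun X Y f => compm1 f) (fun X Y f => comp1m f)
    (fun X Y Z W h g f => compmA h g f).

Definition full_inclusion (C : category) (P : C -> Prop) :
    functor (full_subcategory P) C :=
  @Functor (full_subcategory P) C (fun X => sval X) (fun X Y f => f)
    (fun X => erefl) (fun X Y Z g f => erefl).

Section Slice.
Variables (C : category) (B : C).

Record slice_obj := SliceObj { slice_dom : C; slice_arr : hom slice_dom B }.

Record slice_hom (X Y : slice_obj) := SliceHom {
  slice_map : hom (slice_dom X) (slice_dom Y);
  slice_mapP : slice_arr Y ∘ slice_map = slice_arr X
}.

Lemma slice_hom_eq (X Y : slice_obj) (f g : slice_hom X Y) :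
  slice_map f = slice_map g -> f = g.
Proof.
case: f g => [f pf] [g pg] /= efg; case: _ / efg pg => pg.
by rewrite (Prop_irrelevance pf pg).
Qed.

Lemma slice_id_subproof (X : slice_obj) :
  slice_arr X ∘ idm (slice_dom X) = slice_arr X.
Proof. exact: compm1. Qed.

Lemma slice_comp_subproof (X Y Z : slice_obj)
    (g : slice_hom Y Z) (f : slice_hom X Y) :
  slice_arr Z ∘ (slice_map g ∘ slice_map f) = slice_arr X.
Proof. by rewrite compmA !slice_mapP. Qed.

Definition slice_id (X : slice_obj) : slice_hom X X :=
  SliceHom (slice_id_subproof X).

Definition slice_comp (X Y Z : slice_obj)
    (g : slice_hom Y Z) (f : slice_hom X Y) : slice_hom X Z :=
  SliceHom (slice_comp_subproof g f).

Lemma slice_comp1 X Y (f : slice_hom X Y) : slice_comp f (slice_id X) = f.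
Proof. by apply: slice_hom_eq; exact: compm1. Qed.

Lemma slice_1comp X Y (f : slice_hom X Y) : slice_comp (slice_id Y) f = f.
Proof. by apply: slice_hom_eq; exact: comp1m. Qed.

Lemma slice_compA X Y Z W (h : slice_hom Z W) (g : slice_hom Y Z)
    (f : slice_hom X Y) :
  slice_comp h (slice_comp g f) = slice_comp (slice_comp h g) f.
Proof. by apply: slice_hom_eq; exact: compmA. Qed.

Definition slice : category :=
  Category slice_comp1 slice_1comp slice_compA.

End Slice.

Record graph := MkGraph {
  vertex : Type;
  edge : Type;
  src : edge -> vertex;
  tgt : edge -> vertex
}.

Arguments src {g} e.
Arguments tgt {g} e.

Record graph_hom (G H : graph) := GraphHom {
  vmap : vertex G -> vertex H;
  emap : edge G -> edge H;
  emap_src : forall e, src (emap e) = vmap (src e);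
  emap_tgt : forall e, tgt (emap e) = vmap (tgt e)
}.

Lemma graph_hom_eq (G H : graph) (f g : graph_hom G H) :
  vmap f = vmap g -> emap f = emap g -> f = g.
Proof.
case: f g => [fv fe fs ft] [gv ge gs gt] /= ev ee.
case: _ / ev gs gt; case: _ / ee => gs gt.
by rewrite (Prop_irrelevance fs gs) (Prop_irrelevance ft gt).
Qed.

Definition graph_id (G : graph) : graph_hom G G :=
  @GraphHom G G id id (fun=> erefl) (fun=> erefl).

Lemma graph_comp_src (G H K : graph) (g : graph_hom H K) (f : graph_hom G H) e :
  src (emap g (emap f e)) = vmap g (vmap f (src e)).
Proof. by rewrite !emap_src. Qed.

Lemma graph_comp_tgt (G H K : graph) (g : graph_hom H K) (f : graph_hom G H) e :
  tgt (emap g (emap f e)) = vmap g (vmap f (tgt e)).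
Proof. by rewrite !emap_tgt. Qed.

Definition graph_comp (G H K : graph) (g : graph_hom H K) (f : graph_hom G H) :
    graph_hom G K :=
  @GraphHom G K (fun v => vmap g (vmap f v)) (fun e => emap g (emap f e))
    (graph_comp_src g f) (graph_comp_tgt g f).

Lemma graph_comp1 G H (f : graph_hom G H) : graph_comp f (graph_id G) = f.
Proof. exact: graph_hom_eq. Qed.

Lemma graph_1comp G H (f : graph_hom G H) : graph_comp (graph_id H) f = f.
Proof. exact: graph_hom_eq. Qed.

Lemma graph_compA G H K L (h : graph_hom K L) (g : graph_hom H K)
    (f : graph_hom G H) :
  graph_comp h (graph_comp g f) = graph_comp (graph_comp h g) f.
Proof. exact: graph_hom_eq. Qed.

Definition Graph : category := Category graph_comp1 graph_1comp graph_compA.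

(* The set of edges incident to v: an edge is counted once even when it is a
   self-loop at v. *)
Definition incident (G : graph) (v : vertex G) : Type :=
  {e : edge G | src e = v \/ tgt e = v}.

Lemma incident_map_subproof (G H : graph) (f : graph_hom G H) (v : vertex G)
    (e : edge G) :
  src e = v \/ tgt e = v ->
  src (emap f e) = vmap f v \/ tgt (emap f e) = vmap f v.
Proof. by rewrite emap_src emap_tgt; case=> ->; [left | right]. Qed.

Definition incident_map (G H : graph) (f : graph_hom G H) (v : vertex G)
    (e : incident v) : incident (vmap f v) :=
  exist _ (emap f (sval e)) (incident_map_subproof f (svalP e)).

Record monoidal_signature := MonoidalSignature {
  sig_obj : Type;
  sig_mor : Type;
  sig_dom : sig_mor -> seq sig_obj;
  sig_cod : sig_mor -> seq sig_obj
}.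

Arguments sig_dom {m} f.
Arguments sig_cod {m} f.

Section StringGraphs.
Variable T : monoidal_signature.

Inductive typegraph_edge : Type :=
  | tg_mid (X : sig_obj T)
  | tg_in (f : sig_mor T) (i : 'I_(size (sig_dom f)))
  | tg_out (f : sig_mor T) (j : 'I_(size (sig_cod f))).

Definition typegraph_src (e : typegraph_edge) : sig_obj T + sig_mor T :=
  match e with
  | tg_mid X => inl X
  | tg_in f i => inl (tnth (in_tuple (sig_dom f)) i)
  | tg_out f _ => inr f
  end.

Definition typegraph_tgt (e : typegraph_edge) : sig_obj T + sig_mor T :=
  match e with
  | tg_mid X => inl X
  | tg_in f _ => inr f
  | tg_out f j => inl (tnth (in_tuple (sig_cod f)) j)
  end.

Definition typegraph : graph := MkGraph typegraph_src typegraph_tgt.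

Definition typed_graph : category := @slice Graph typegraph.

Section Vertices.
Variable G : typed_graph.

Definition carrier : graph := slice_dom G.
Definition typing : graph_hom carrier typegraph := slice_arr G.

Definition is_wire_vertex (v : vertex carrier) : Prop :=
  exists X : sig_obj T, vmap typing v = inl X.

Definition is_box_vertex (v : vertex carrier) : Prop :=
  exists f : sig_mor T, vmap typing v = inr f.

Definition is_string_graph : Prop :=
  [/\ forall v, is_wire_vertex v ->
        forall e e' : edge carrier, tgt e = v -> tgt e' = v -> e = e',
      forall v, is_wire_vertex v ->
        forall e e' : edge carrier, src e = v -> src e' = v -> e = e' &
      forall b, is_box_vertex b -> bijective (@incident_map _ _ typing b)].

End Vertices.

Definition SGraph : category := full_subcategory is_string_graph.

Definition SGraph_embedding : functor SGraph typed_graph :=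
  full_inclusion is_string_graph.

End StringGraphs.

(* Main.v *)
(* Limits, monomorphisms and pushouts along monomorphisms in a slice of Graph
   are computed on the sets of vertices and edges, so adhesivity reduces to the
   van Kampen property of pushouts along injections of sets.

   For the preservation of monomorphisms, let m be a monomorphism of string
   graphs. A graph with one vertex and no edge, typed by a wire or by a box
   without inputs and outputs, is a string graph; probing with it shows that m
   is injective on wire-vertices and on isolated box-vertices. Every edge has an
   endpoint that is a wire-vertex, which determines the edge among those with
   the same direction, so m is injective on edges; finally a non-isolated
   box-vertex is recovered from any of its edges. *)

From mathcomp Require Import all_boot.
From mathcomp Require Import boolp.
Require Import Defs.

Set Implicit Arguments.
Unset Strict Implicit.
Unset Printing Implicit Defensive.

(** * Pullbacks of sets and pushouts of sets along injections *)

Lemma functional_choice (X Y : Type) (P : X -> Y -> Prop) :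
  (forall x, exists y, P x y) -> exists f, forall x, P x (f x).
Proof. by move=> /choice[f fP]; exists f. Qed.

Definition set_pullback (P A B Z : Type) (p : P -> A) (q : P -> B)
    (f : A -> Z) (g : B -> Z) : Prop :=
  [/\ forall x, f (p x) = g (q x),
      forall a b, f a = g b -> exists x, p x = a /\ q x = b &
      forall x y, p x = p y -> q x = q y -> x = y].

(* For injective [f], this says that [Q] is the disjoint union of the image of
   [B] and of the complement of the image of [f]. *)
Definition set_pushout (Z A B Q : Type) (f : Z -> A) (g : Z -> B)
    (h : A -> Q) (k : B -> Q) : Prop :=
  [/\ forall z, h (f z) = k (g z),
      forall q, (exists b, k b = q) \/
                (exists2 a, ~ (exists z, f z = a) & h a = q),
      injective k,
      forall a a', ~ (exists z, f z = a) -> ~ (exists z, f z = a') ->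
        h a = h a' -> a = a' &
      forall a b, h a = k b -> exists z, f z = a].

Lemma set_pullback_exists (A B Z : Type) (f : A -> Z) (g : B -> Z) :
  exists P (p : P -> A) (q : P -> B), set_pullback p q f g.
Proof.
exists {x : A * B | f x.1 = g x.2}, (fun x => (sval x).1), (fun x => (sval x).2).
split=> [[x e] //|a b e|[[a b] e] [[a' b'] e'] /= ea eb].
  by exists (exist _ (a, b) e).
by subst; rewrite (Prop_irrelevance e e').
Qed.

Lemma set_pullback_lift (P A B Z : Type) (p : P -> A) (q : P -> B)
    (f : A -> Z) (g : B -> Z) (W : Type) (a : W -> A) (b : W -> B) :
  set_pullback p q f g -> (forall w, f (a w) = g (b w)) ->
  exists u, forall w, p (u w) = a w /\ q (u w) = b w.
Proof.
move=> [_ ex _] ab.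
by apply: (functional_choice (P := fun w x => p x = a w /\ q x = b w)) => w; apply: ex.
Qed.

(** With [u] and [v] the comparison maps, this carries the elementwise description over to an
    arbitrary pullback; [cancel u v] enters through the injectivity of [u]. *)
Lemma set_pullback_retract (P P' A B Z : Type) (p : P -> A) (q : P -> B)
    (p' : P' -> A) (q' : P' -> B) (f : A -> Z) (g : B -> Z)
    (u : P -> P') (v : P' -> P) :
  set_pullback p' q' f g ->
  (forall x, p' (u x) = p x) -> (forall x, q' (u x) = q x) ->
  (forall x, p (v x) = p' x) -> (forall x, q (v x) = q' x) ->
  cancel u v -> set_pullback p q f g.
Proof.
move=> [c ex un] pu qu pv qv uK; split=> [x|a b /ex[x [<- <-]]|x y epx eqx].
- by rewrite -pu -qu.
- by exists (v x).
- by apply: (can_inj uK); apply: un; rewrite ?pu ?qu.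
Qed.

Lemma set_pushout_exists (Z A B : Type) (f : Z -> A) (g : Z -> B) :
  injective f -> exists Q (h : A -> Q) (k : B -> Q), set_pushout f g h k.
Proof.
move=> fI; pose Q : Type := (B + {a | ~ exists z, f z = a})%type.
(* Membership in the image of [f] is settled only by excluded middle in [Prop], so [h] is specified
   on and off the image and then obtained by choice. *)
have [h hP] : exists h : A -> Q, forall a,
    (forall z, f z = a -> h a = inl (g z)) /\
    (forall na : ~ exists z, f z = a, h a = inr (exist _ a na)).
  apply: (functional_choice (P := fun a y => (forall z, f z = a -> y = inl (g z)) /\
    (forall na : ~ exists z, f z = a, y = inr (exist _ a na)))) => a.
  case: (EM (exists z, f z = a)) => [[z <-]|na].
    exists (inl (g z)); split=> [y /fI -> //|na].
    by case: na; exists z.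
  exists (inr (exist _ a na)); split=> [z e|na'].
    by case: na; exists z.
  by rewrite (Prop_irrelevance na na').
exists Q, h, inl; split=> [z|[b|[a na]]|b b' [] //|a a' na na'|a b].
- exact: (hP _).1.
- by left; exists b.
- by right; exists a => //; apply: (hP a).2.
- by rewrite ((hP a).2 na) ((hP a').2 na') => -[].
- by move=> e; apply: contrapT => na; move: e; rewrite ((hP a).2 na).
Qed.

Lemma set_pushout_desc (Z A B Q : Type) (f : Z -> A) (g : Z -> B)
    (h : A -> Q) (k : B -> Q) (W : Type) (a : A -> W) (b : B -> W) :
  set_pushout f g h k -> (forall z, a (f z) = b (g z)) ->
  exists u, (forall x, u (h x) = a x) /\ (forall y, u (k y) = b y).
Proof.
move=> [c cov kI hI hk] ab.
have [u uP] : exists u : Q -> W, forall q,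
    (forall x, h x = q -> u q = a x) /\ (forall y, k y = q -> u q = b y).
  apply: (functional_choice (P := fun q w => (forall x, h x = q -> w = a x) /\
    (forall y, k y = q -> w = b y))) => q.
  case: (cov q) => [[y <-]|[x nx <-]].
    (* An [x] over [k y] lies in the image of [f] by [hk], which forces the value [b y]. *)
    exists (b y); split=> [x e|y' /kI -> //].
    have [z zx] := hk _ _ e; subst x.
    by rewrite ab; congr b; apply: kI; rewrite -c.
  exists (a x); split=> [x' e|y /esym /hk //].
  (* An [x'] in the image of [f] would put [h x] into the image of [k], hence [x] into that of
     [f]. *)
  case: (EM (exists z, f z = x')) => [[z zx']|nx'].
    by subst x'; case: nx; apply: (hk _ (g z)); rewrite -e.
  by congr a; apply: hI.
by exists u; split=> x; [apply: (uP _).1 | apply: (uP _).2].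
Qed.

Lemma set_pushout_ext (Z A B Q : Type) (f : Z -> A) (g : Z -> B)
    (h : A -> Q) (k : B -> Q) (W : Type) (u u' : Q -> W) :
  set_pushout f g h k -> (forall x, u (h x) = u' (h x)) ->
  (forall y, u (k y) = u' (k y)) -> u =1 u'.
Proof. by move=> [_ cov _ _ _] uh uk q; case: (cov q) => [[y <-]|[x _ <-]]. Qed.

Lemma set_pushout_retract (Z A B Q Q' : Type) (f : Z -> A) (g : Z -> B)
    (h : A -> Q) (k : B -> Q) (h' : A -> Q') (k' : B -> Q')
    (u : Q -> Q') (v : Q' -> Q) :
  set_pushout f g h' k' ->
  (forall x, u (h x) = h' x) -> (forall y, u (k y) = k' y) ->
  (forall x, v (h' x) = h x) -> (forall y, v (k' y) = k y) ->
  cancel u v -> set_pushout f g h k.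
Proof.
move=> [c cov kI hI hk] uh uk vh vk uK.
split=> [z|q|y y' e|x x' nx nx' e|x y e].
- by rewrite -vh -vk c.
- rewrite -(uK q); case: (cov (u q)) => [[y <-]|[x nx <-]].
    by left; exists y.
  by right; exists x.
- by apply: kI; rewrite -!uk e.
- by apply: hI => //; rewrite -!uh e.
- by apply: (hk _ y); rewrite -uh -uk e.
Qed.

(** * The van Kampen property for sets *)

Section SetCube.
Variables (Z A B Q Z' A' B' Q' : Type).
Variables (f : Z -> A) (g : Z -> B) (h : A -> Q) (k : B -> Q).
Variables (f' : Z' -> A') (g' : Z' -> B') (h' : A' -> Q') (k' : B' -> Q').
Variables (z : Z' -> Z) (a : A' -> A) (b : B' -> B) (q : Q' -> Q).
Hypothesis fI : injective f.
Hypothesis bottom : set_pushout f g h k.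
Hypothesis top_comm : forall x, h' (f' x) = k' (g' x).
Hypothesis front_h_comm : forall x, q (h' x) = h (a x).
Hypothesis front_k_comm : forall y, q (k' y) = k (b y).
Hypothesis back_f : set_pullback f' z a f.
Hypothesis back_g : set_pullback g' z b g.

(** By the pullback [back_f], [a] respects the splitting of [A'] and [A] into image and complement
    on which the two pushouts rest. *)
Lemma back_f_image x : (exists w, f w = a x) <-> exists w, f' w = x.
Proof.
have [c ex _] := back_f; split=> [[w /esym /ex[w' [<- _]]]|[w <-]].
  by exists w'.
by exists (z w); rewrite c.
Qed.

Lemma set_van_kampen_fronts : set_pushout f' g' h' k' ->
  set_pullback h' a q h /\ set_pullback k' b q k.
Proof.
have [c cov kI hI hk] := bottom; move=> [c' cov' kI' hI' hk'].
have [cf exf unf] := back_f; have [cg exg ung] := back_g.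
split; split=> //; last by move=> x y /kI'.
(* A point of [Q'] that comes from [B'] and lies over [h a0] is lifted through the pullback
   [back_g]; one that comes from off the image of [f'] has its lift at hand. *)
- move=> q0 a0; case: (cov' q0) => [[y <-]|[x nx <-]].
    rewrite front_k_comm => e; have [w wa0] := hk _ _ (esym e); subst a0.
    have /exg[w' [<- <-]] : b y = g w by apply: kI; rewrite e c.
    by exists (f' w'); rewrite cf.
  rewrite front_h_comm => e; exists x; split=> //.
  have nax : ~ exists w, f w = a x by move/back_f_image.
  apply: hI => // -[w wa0]; apply: nax; subst a0.
  by apply: (hk _ (g w)); rewrite e c.
(* On the image of [f'], the maps [g'] and [z] jointly separate points, and [z] is compared through
   the injective [f]; off the image, [h'] is injective. *)
- move=> x y eh ea; case: (EM (exists w, f' w = x)) => [[w wx]|nx].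
    subst x; have [w' wy] : exists w', f' w' = y.
      by apply: (hk' _ (g' w)); rewrite -eh c'.
    subst y; congr f'; apply: ung; first by apply: kI'; rewrite -!c'.
    by apply: fI; rewrite -!cf.
  apply: hI' => // -[w wy]; apply: nx; apply: (hk' _ (g' w)).
  by rewrite eh -wy c'.
- move=> q0 b0; case: (cov' q0) => [[y <-]|[x nx <-]].
    by rewrite front_k_comm => /kI <-; exists y.
  (* This case is void: [a x] would lie in the image of [f], hence [x] in that of [f']. *)
  by rewrite front_h_comm => /hk /back_f_image.
Qed.

(** Each clause is inherited from the bottom square: points of [Q'] are located by [q] and lifted
    through the front pullbacks. *)
Lemma set_van_kampen_top :
  set_pullback h' a q h -> set_pullback k' b q k -> set_pushout f' g' h' k'.
Proof.
have [c cov kI hI hk] := bottom; move=> [_ exh unh] [_ exk unk].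
split=> // [q0|y y' e|x x' nx nx' e|x y e].
- case: (cov (q q0)) => [[y /esym /exk[y' [<- _]]]|[x nx /esym /exh[x' [<- ex]]]].
    by left; exists y'.
  by right; exists x' => // /back_f_image; rewrite ex.
- by apply: unk => //; apply: kI; rewrite -!front_k_comm e.
- apply: unh => //; apply: hI; try by move/back_f_image.
  by rewrite -!front_h_comm e.
- apply/back_f_image; apply: (hk _ (b y)).
  by rewrite -front_h_comm -front_k_comm e.
Qed.

End SetCube.

(** * Comparison maps and monomorphisms in an arbitrary category *)

Section UniversalProperties.
Variable C : category.

Lemma is_pullback_retract (P P' A B Z : C) (p : hom P A) (q : hom P B)
    (p' : hom P' A) (q' : hom P' B) (f : hom A Z) (g : hom B Z) :
  is_pullback p q f g -> is_pullback p' q' f g ->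
  exists (u : hom P P') (v : hom P' P),
    [/\ p' ∘ u = p, q' ∘ u = q, p ∘ v = p', q ∘ v = q' & v ∘ u = idm P].
Proof.
move=> [c un] [c' un'].
have [u [[pu qu] _]] := un' _ _ _ c; have [v [[pv qv] _]] := un _ _ _ c'.
exists u, v; split=> //; have [w [_ wP]] := un _ _ _ c.
by rewrite -(wP (v ∘ u)) ?(wP (idm P)) // ?compm1 // !compmA pv qv.
Qed.

Lemma is_pushout_retract (Z A B Q Q' : C) (f : hom Z A) (g : hom Z B)
    (h : hom A Q) (k : hom B Q) (h' : hom A Q') (k' : hom B Q') :
  is_pushout f g h k -> is_pushout f g h' k' ->
  exists (u : hom Q Q') (v : hom Q' Q),
    [/\ u ∘ h = h', u ∘ k = k', v ∘ h' = h, v ∘ k' = k & v ∘ u = idm Q].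
Proof.
move=> [c un] [c' un'].
have [u [[uh uk] _]] := un _ _ _ c'; have [v [[vh vk] _]] := un' _ _ _ c.
exists u, v; split=> //; have [w [_ wP]] := un _ _ _ c.
by rewrite -(wP (v ∘ u)) ?(wP (idm Q)) // ?comp1m // -!compmA uh uk.
Qed.

(** The trivial kernel pair turns being mono into a pullback condition, which in graphs can be read
    on elements. *)
Lemma mono_pullback (X Y : C) (m : hom X Y) :
  mono m -> is_pullback (idm X) (idm X) m m.
Proof.
move=> mm; split=> // W a b /mm <-; exists a.
by split=> [|u [<- _]]; rewrite comp1m.
Qed.

(** Applied to the back face over the mono leg, this makes the top span of a cube a span along a
    monomorphism too. *)
Lemma mono_pullback_stable (P A B Z : C) (p : hom P A)
    (q : hom P B) (f : hom A Z) (g : hom B Z) :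
  is_pullback p q f g -> mono g -> mono p.
Proof.
move=> [c un] gM W u v puv; have cu : f ∘ (p ∘ u) = g ∘ (q ∘ u).
  by rewrite !compmA c.
have [w [_ wP]] := un _ _ _ cu; rewrite -(wP u) // -(wP v) //; split=> //.
by apply: gM; rewrite !compmA -c -!compmA puv.
Qed.

End UniversalProperties.

(** * Elementwise pullbacks and pushouts, and adhesivity, in slices of [Graph] *)

Section GraphSlice.
Variable B : graph.

Notation typed := (@slice Graph B).

Definition typed_graph_of (X : typed) : graph := slice_dom X.
Definition typed_arr (X : typed) : graph_hom (typed_graph_of X) B := slice_arr X.
Definition typed_map (X Y : typed) (f : hom X Y) :
  graph_hom (typed_graph_of X) (typed_graph_of Y) := slice_map f.

Notation V := (fun X => vertex (typed_graph_of X)).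
Notation E := (fun X => edge (typed_graph_of X)).
Definition onV (X Y : typed) (f : hom X Y) : V X -> V Y := vmap (typed_map f).
Definition onE (X Y : typed) (f : hom X Y) : E X -> E Y := emap (typed_map f).

Lemma typed_hom_ext (X Y : typed) (f g : hom X Y) :
  onV f =1 onV g -> onE f =1 onE g -> f = g.
Proof.
move=> eV eE; apply: slice_hom_eq; apply: graph_hom_eq; apply: funext.
  exact: eV.
exact: eE.
Qed.

Lemma onV_comp (X Y Z : typed) (g : hom Y Z) (f : hom X Y) x :
  onV (g ∘ f) x = onV g (onV f x).
Proof. by []. Qed.

Lemma onE_comp (X Y Z : typed) (g : hom Y Z) (f : hom X Y) x :
  onE (g ∘ f) x = onE g (onE f x).
Proof. by []. Qed.

Lemma onE_src (X Y : typed) (f : hom X Y) x : src (onE f x) = onV f (src x).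
Proof. exact: emap_src. Qed.

Lemma onE_tgt (X Y : typed) (f : hom X Y) x : tgt (onE f x) = onV f (tgt x).
Proof. exact: emap_tgt. Qed.

Lemma onV_arr (X Y : typed) (f : hom X Y) x :
  vmap (typed_arr Y) (onV f x) = vmap (typed_arr X) x.
Proof. by rewrite /typed_arr -(slice_mapP f). Qed.

Lemma onE_arr (X Y : typed) (f : hom X Y) x :
  emap (typed_arr Y) (onE f x) = emap (typed_arr X) x.
Proof. by rewrite /typed_arr -(slice_mapP f). Qed.

Lemma typed_hom_exists (X Y : typed) (fV : V X -> V Y) (fE : E X -> E Y) :
  (forall e, src (fE e) = fV (src e)) -> (forall e, tgt (fE e) = fV (tgt e)) ->
  (forall x, vmap (typed_arr Y) (fV x) = vmap (typed_arr X) x) ->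
  (forall x, emap (typed_arr Y) (fE x) = emap (typed_arr X) x) ->
  exists f : hom X Y, onV f = fV /\ onE f = fE.
Proof.
move=> fs ft aV aE; pose m : @hom Graph (slice_dom X) (slice_dom Y) :=
  @GraphHom (typed_graph_of X) (typed_graph_of Y) fV fE fs ft.
have mP : slice_arr Y ∘ m = slice_arr X.
  by apply: graph_hom_eq; apply: funext; [apply: aV | apply: aE].
by exists (@SliceHom Graph B X Y m mP).
Qed.

Lemma square_onV (X Y Y' Z : typed) (g : hom Y Z) (f : hom X Y)
    (g' : hom Y' Z) (f' : hom X Y') :
  g ∘ f = g' ∘ f' -> forall x, onV g (onV f x) = onV g' (onV f' x).
Proof. by move=> e x; rewrite -!onV_comp e. Qed.

Lemma square_onE (X Y Y' Z : typed) (g : hom Y Z) (f : hom X Y)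
    (g' : hom Y' Z) (f' : hom X Y') :
  g ∘ f = g' ∘ f' -> forall x, onE g (onE f x) = onE g' (onE f' x).
Proof. by move=> e x; rewrite -!onE_comp e. Qed.

Definition pointwise_pullback (P A B' Z : typed) (p : hom P A) (q : hom P B')
    (f : hom A Z) (g : hom B' Z) : Prop :=
  set_pullback (onV p) (onV q) (onV f) (onV g) /\
  set_pullback (onE p) (onE q) (onE f) (onE g).

Definition pointwise_pushout (Z A B' Q : typed) (f : hom Z A) (g : hom Z B')
    (h : hom A Q) (k : hom B' Q) : Prop :=
  set_pushout (onV f) (onV g) (onV h) (onV k) /\
  set_pushout (onE f) (onE g) (onE h) (onE k).

Lemma pointwise_is_pullback (P A B' Z : typed) (p : hom P A) (q : hom P B')
    (f : hom A Z) (g : hom B' Z) :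
  pointwise_pullback p q f g -> is_pullback p q f g.
Proof.
move=> [pbV pbE]; have [cV _ unV] := pbV; have [cE _ unE] := pbE.
split=> [|W a b ab]; first exact: typed_hom_ext.
have [uV uVP] := set_pullback_lift pbV (square_onV ab).
have [uE uEP] := set_pullback_lift pbE (square_onE ab).
have [|||| u [euV euE]] := @typed_hom_exists W P uV uE.
(* The lifts on vertices and on edges were chosen separately; they fit together because [p] and [q]
   jointly separate the vertices of [P]. *)
- move=> e; have [pe qe] := uEP e; have [ps qs] := uVP (src e).
  by apply: unV; rewrite -onE_src ?pe ?qe ?ps ?qs onE_src.
- move=> e; have [pe qe] := uEP e; have [pt qt] := uVP (tgt e).
  by apply: unV; rewrite -onE_tgt ?pe ?qe ?pt ?qt onE_tgt.
- by move=> x; rewrite -(onV_arr p) (uVP x).1 onV_arr.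
- by move=> x; rewrite -(onE_arr p) (uEP x).1 onE_arr.
exists u; split=> [|u' [pu' qu']].
  split; apply: typed_hom_ext => x; rewrite ?onV_comp ?onE_comp ?euV ?euE;
    by [apply: (uVP x).1 | apply: (uEP x).1 | apply: (uVP x).2 | apply: (uEP x).2].
apply: typed_hom_ext => x; rewrite ?euV ?euE.
  have [pu qu] := uVP x.
  by apply: unV; rewrite ?pu ?qu -onV_comp ?pu' ?qu'.
have [pu qu] := uEP x.
by apply: unE; rewrite ?pu ?qu -onE_comp ?pu' ?qu'.
Qed.

Lemma pointwise_pullback_exists (A B' Z : typed) (f : hom A Z) (g : hom B' Z) :
  exists (P : typed) (p : hom P A) (q : hom P B'), pointwise_pullback p q f g.
Proof.
have [PV [pV [qV pbV]]] := set_pullback_exists (onV f) (onV g).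
have [PE [pE [qE pbE]]] := set_pullback_exists (onE f) (onE g).
have [cV _ _] := pbV; have [cE _ _] := pbE.
(* The source of an edge of the pullback is the lift of the pair of sources of its two projections;
   targets are alike. *)
have [|s sP] := set_pullback_lift
  (a := fun e => src (pE e)) (b := fun e => src (qE e)) pbV.
  by move=> e; rewrite -!onE_src cE.
have [|t tP] := set_pullback_lift
  (a := fun e => tgt (pE e)) (b := fun e => tgt (qE e)) pbV.
  by move=> e; rewrite -!onE_tgt cE.
pose G := MkGraph s t.
have arr_src e : src (emap (typed_arr A) (pE e)) = vmap (typed_arr A) (pV (s e)).
  by rewrite emap_src (sP e).1.
have arr_tgt e : tgt (emap (typed_arr A) (pE e)) = vmap (typed_arr A) (pV (t e)).
  by rewrite emap_tgt (tP e).1.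
pose P : typed := @SliceObj Graph B G (@GraphHom G B
  (fun x => vmap (typed_arr A) (pV x)) (fun x => emap (typed_arr A) (pE x))
  arr_src arr_tgt).
have [|||| p [epV epE]] := @typed_hom_exists P A pV pE => //.
- by move=> e; rewrite (sP e).1.
- by move=> e; rewrite (tP e).1.
have [|||| q [eqV eqE]] := @typed_hom_exists P B' qV qE => //.
- by move=> e; rewrite (sP e).2.
- by move=> e; rewrite (tP e).2.
- by move=> x; rewrite -(onV_arr g) -cV onV_arr.
- by move=> x; rewrite -(onE_arr g) -cE onE_arr.
by exists P, p, q; rewrite /pointwise_pullback epV epE eqV eqE.
Qed.

(** The constructed pullback is elementwise, and the comparison maps transport this to any other. *)
Lemma is_pullback_pointwise (P A B' Z : typed) (p : hom P A) (q : hom P B')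
    (f : hom A Z) (g : hom B' Z) :
  is_pullback p q f g <-> pointwise_pullback p q f g.
Proof.
split; last exact: pointwise_is_pullback.
move=> pb; have [P' [p' [q' ppb]]] := pointwise_pullback_exists f g.
have [u [v [pu qu pv qv vu]]] :=
  is_pullback_retract pb (pointwise_is_pullback ppb).
have [ppbV ppbE] := ppb; split.
  by apply: (set_pullback_retract (u := onV u) (v := onV v) ppbV) => x;
    rewrite -onV_comp ?pu ?qu ?pv ?qv ?vu.
by apply: (set_pullback_retract (u := onE u) (v := onE v) ppbE) => x;
  rewrite -onE_comp ?pu ?qu ?pv ?qv ?vu.
Qed.

(** For the direct implication, the kernel pair given by identities is elementwise: two elements
    with equal images both come from one element. *)
Lemma mono_injective (X Y : typed) (m : hom X Y) :
  mono m <-> injective (onV m) /\ injective (onE m).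
Proof.
split=> [/mono_pullback/is_pullback_pointwise [[_ exV _] [_ exE _]]|[mV mE]].
  by split=> x y; [move=> /exV | move=> /exE] => -[w [<- <-]].
move=> Z f g e; apply: typed_hom_ext => x; [apply: mV | apply: mE].
  exact: square_onV e x.
exact: square_onE e x.
Qed.

Lemma pointwise_is_pushout (Z A B' Q : typed) (f : hom Z A) (g : hom Z B')
    (h : hom A Q) (k : hom B' Q) :
  pointwise_pushout f g h k -> is_pushout f g h k.
Proof.
move=> [poV poE]; have [cV _ _ _ _] := poV; have [cE _ _ _ _] := poE.
split=> [|W a b ab]; first exact: typed_hom_ext.
have [uV [uhV ukV]] := set_pushout_desc poV (square_onV ab).
have [uE [uhE ukE]] := set_pushout_desc poE (square_onE ab).
have [|||| u [euV euE]] := @typed_hom_exists Q W uV uE.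
- by apply: (set_pushout_ext poE) => e;
    rewrite ?uhE ?ukE !onE_src ?uhV ?ukV.
- by apply: (set_pushout_ext poE) => e;
    rewrite ?uhE ?ukE !onE_tgt ?uhV ?ukV.
- by apply: (set_pushout_ext poV) => x; rewrite ?uhV ?ukV !onV_arr.
- by apply: (set_pushout_ext poE) => x; rewrite ?uhE ?ukE !onE_arr.
exists u; split=> [|u' [u'h u'k]].
  by split; apply: typed_hom_ext => x; rewrite ?onV_comp ?onE_comp ?euV ?euE.
apply: typed_hom_ext; rewrite ?euV ?euE.
  by apply: (set_pushout_ext poV) => x; rewrite ?uhV ?ukV -onV_comp ?u'h ?u'k.
by apply: (set_pushout_ext poE) => x; rewrite ?uhE ?ukE -onE_comp ?u'h ?u'k.
Qed.

Lemma pointwise_pushout_exists (Z A B' : typed) (f : hom Z A) (g : hom Z B') :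
  mono f ->
  exists (Q : typed) (h : hom A Q) (k : hom B' Q), pointwise_pushout f g h k.
Proof.
move=> /mono_injective[fV fE].
have [QV [hV [kV poV]]] := set_pushout_exists (onV g) fV.
have [QE [hE [kE poE]]] := set_pushout_exists (onE g) fE.
have [cV _ _ _ _] := poV; have [cE _ _ _ _] := poE.
have [|s [sh sk]] := set_pushout_desc
  (a := fun e => hV (src e)) (b := fun e => kV (src e)) poE.
  by move=> e; rewrite !onE_src cV.
have [|t [th tk]] := set_pushout_desc
  (a := fun e => hV (tgt e)) (b := fun e => kV (tgt e)) poE.
  by move=> e; rewrite !onE_tgt cV.
have [|aV [aVh aVk]] := set_pushout_desc
  (a := vmap (typed_arr A)) (b := vmap (typed_arr B')) poV.
  by move=> x; rewrite !onV_arr.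
have [|aE [aEh aEk]] := set_pushout_desc
  (a := emap (typed_arr A)) (b := emap (typed_arr B')) poE.
  by move=> x; rewrite !onE_arr.
pose G := MkGraph s t.
have arr_src : forall e, src (aE e) = aV (s e).
  by apply: (set_pushout_ext poE) => e;
    rewrite ?aEh ?aEk emap_src ?sh ?sk ?aVh ?aVk.
have arr_tgt : forall e, tgt (aE e) = aV (t e).
  by apply: (set_pushout_ext poE) => e;
    rewrite ?aEh ?aEk emap_tgt ?th ?tk ?aVh ?aVk.
pose Q : typed := @SliceObj Graph B G (@GraphHom G B aV aE arr_src arr_tgt).
have [|||| h [ehV ehE]] := @typed_hom_exists A Q hV hE => //.
have [|||| k [ekV ekE]] := @typed_hom_exists B' Q kV kE => //.
by exists Q, h, k; rewrite /pointwise_pushout ehV ehE ekV ekE.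
Qed.

Lemma is_pushout_pointwise (Z A B' Q : typed) (f : hom Z A) (g : hom Z B')
    (h : hom A Q) (k : hom B' Q) :
  mono f -> is_pushout f g h k <-> pointwise_pushout f g h k.
Proof.
move=> fM; split; last exact: pointwise_is_pushout.
move=> po; have [Q' [h' [k' ppo]]] := pointwise_pushout_exists g fM.
have [u [v [uh uk vh vk vu]]] :=
  is_pushout_retract po (pointwise_is_pushout ppo).
have [ppoV ppoE] := ppo; split.
  by apply: (set_pushout_retract (u := onV u) (v := onV v) ppoV) => x;
    rewrite -onV_comp ?uh ?uk ?vh ?vk ?vu.
by apply: (set_pushout_retract (u := onE u) (v := onE v) ppoE) => x;
  rewrite -onE_comp ?uh ?uk ?vh ?vk ?vu.
Qed.

Theorem graph_slice_adhesive : adhesive typed.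
Proof.
split=> [A B' Z f g|Z A B' f g fM|Z A B' Q f g h k fM po].
- have [P [p [q pb]]] := pointwise_pullback_exists f g.
  by exists P, p, q; apply/is_pullback_pointwise.
- have [Q [h [k po]]] := pointwise_pushout_exists g fM.
  by exists Q, h, k; apply/is_pushout_pointwise.
split=> // Z' A' B'' Q' f' g' h' k' z a b q top qh qk bf bg.
have f'M : mono f' := mono_pullback_stable bf fM.
have [fV fE] := (mono_injective f).1 fM.
have [poV poE] := (is_pushout_pointwise g h k fM).1 po.
have [bfV bfE] := (is_pullback_pointwise f' z a f).1 bf.
have [bgV bgE] := (is_pullback_pointwise g' z b g).1 bg.
split.
  move=> /(is_pushout_pointwise g' h' k' f'M)[poV' poE'].
  have [? ?] := set_van_kampen_fronts
    fV poV (square_onV top) (square_onV qh) (square_onV qk) bfV bgV poV'.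
  have [? ?] := set_van_kampen_fronts
    fE poE (square_onE top) (square_onE qh) (square_onE qk) bfE bgE poE'.
  by split; apply/is_pullback_pointwise.
move=> [/is_pullback_pointwise[hV hE] /is_pullback_pointwise[kV kE]].
apply/(is_pushout_pointwise g' h' k' f'M); split.
  exact: set_van_kampen_top
    poV (square_onV top) (square_onV qh) (square_onV qk) bfV hV kV.
exact: set_van_kampen_top
  poE (square_onE top) (square_onE qh) (square_onE qk) bfE hE kE.
Qed.

End GraphSlice.

(** * Monomorphisms of string graphs *)

Section StringGraphMonos.
Variable T : monoidal_signature.

Definition point_graph : graph :=
  @MkGraph unit void (fun e => match e with end) (fun e => match e with end).

Definition point_obj (x : vertex (typegraph T)) : typed_graph T :=
  @SliceObj Graph (typegraph T) point_graph
    (@GraphHom point_graph (typegraph T) (fun=> x)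
       (fun e => match e with end) (fun e => match e with end)
       (fun e => match e with end)).

(** A point has no edges, so the bijection on incident edges demands that a box typing it have none
    in [typegraph]; a wire satisfies this vacuously. *)
Definition isolated_if_box (x : vertex (typegraph T)) : Prop :=
  forall f, x = inr f -> incident x -> False.

Lemma point_string_graph x : isolated_if_box x -> is_string_graph (point_obj x).
Proof.
move=> xP; split=> [v _ []|v _ []|b [f /= xf]].
have no := xP f xf.
by exists (fun e => False_rect _ (no e)) => [[[]]|e]; case: (no e).
Qed.

Lemma point_hom (X : typed_graph T) (v : vertex (carrier X)) :
  exists f : hom (point_obj (vmap (typing X) v)) X, onV f tt = v.
Proof.
have [||||f [fV _]] := @typed_hom_exists _ (point_obj (vmap (typing X) v)) X
  (fun=> v) (fun e => match e with end); try by case.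
by exists f; rewrite fV.
Qed.

Variables (X Y : SGraph T) (m : hom X Y).
Hypothesis mM : mono m.

(** Morphisms of [SGraph] are those of the slice, so [m] can be read there. *)
Let m' : @hom (typed_graph T) (sval X) (sval Y) := m.

(** Vertices identified by [m] have equal types, so one point, itself a string graph, maps to both,
    and [mM] cancels [m]. *)
Lemma onV_inj_point v v' : isolated_if_box (vmap (typing (sval X)) v) ->
  onV m' v = onV m' v' -> v = v'.
Proof.
move=> iso e.
have tv : vmap (typing (sval X)) v' = vmap (typing (sval X)) v.
  by have := onV_arr m' v; rewrite e => <-; rewrite onV_arr.
have [f fP] := point_hom v; have [f' fP'] := point_hom v'.
rewrite tv in f' fP' *.
pose P : SGraph T := exist _ _ (point_string_graph iso).
have ff' : f = f' :> @hom (SGraph T) P X.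
  apply: mM; apply: (@typed_hom_ext (typegraph T)) => -[].
  by rewrite !onV_comp fP fP'.
by rewrite -fP -fP' ff'.
Qed.

Lemma onV_inj_wire v v' :
  is_wire_vertex v -> onV m' v = onV m' v' -> v = v'.
Proof. by move=> [x xP]; apply: onV_inj_point => f; rewrite xP. Qed.

Lemma string_mono_onE_inj : injective (onE m').
Proof.
move=> e e' mee'; have [inU outU _] := svalP X.
have st : is_wire_vertex (src e) \/ is_wire_vertex (tgt e).
  have := emap_src (typing (sval X)) e; have := emap_tgt (typing (sval X)) e.
  (* [tg_mid] and [tg_in] start at a wire, [tg_out] ends at one. *)
  case: (emap (typing (sval X)) e) => [x|f i|f j] /= te se.
  - by left; exists x.
  - by left; eexists; rewrite -se.
  - by right; eexists; rewrite -te.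
(* Injectivity on wires equates the wire endpoints of [e] and [e'], and a wire has at most one edge
   in each direction. *)
case: st => w.
  apply: (outU _ w) => //; apply/esym; apply: onV_inj_wire => //.
  by rewrite -!onE_src mee'.
apply: (inU _ w) => //; apply/esym; apply: onV_inj_wire => //.
by rewrite -!onE_tgt mee'.
Qed.

Lemma no_box_box_edge (e : edge (carrier (sval X))) :
  is_box_vertex (src e) -> is_box_vertex (tgt e) -> False.
Proof.
move=> [f sf] [f' tf].
have := emap_src (typing (sval X)) e; have := emap_tgt (typing (sval X)) e.
by rewrite sf tf; case: (emap (typing (sval X)) e).
Qed.

Lemma string_mono_onV_inj : injective (onV m').
Proof.
move=> v v' mvv'; have [_ _ boxX] := svalP X; have [_ _ boxY] := svalP Y.
have tv : vmap (typing (sval X)) v' = vmap (typing (sval X)) v.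
  by have := onV_arr m' v; rewrite mvv' => <-; rewrite onV_arr.
case tvE : (vmap (typing (sval X)) v) => [x|f].
  by apply: (onV_inj_wire _ mvv'); exists x.
have bv : is_box_vertex v by exists f.
have bv' : is_box_vertex v' by exists f; rewrite tv.
case: (EM (exists e : edge (carrier (sval X)), src e = v \/ tgt e = v)); last first.
  (* An edge at the type of [v] would lift to an edge at [v] by the bijection there, so the type is
     isolated and probing with a point applies. *)
  move=> none; apply: (onV_inj_point _ mvv') => _ _ e.
  have [lift _ _] := boxX v bv.
  by apply: none; exists (sval (lift e)); apply: (svalP (lift e)).
move=> [e ev].
(* [e'] is the edge at [v'] that the bijection there assigns to the type of [e]. *)
have [e' e'v' tee'] : exists2 e' : edge (carrier (sval X)),
    src e' = v' \/ tgt e' = v' &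
    emap (typing (sval X)) e' = emap (typing (sval X)) e.
  have [lift _ liftK] := boxX v' bv'.
  have inc := incident_map_subproof (typing (sval X)) ev; rewrite -tv in inc.
  pose e' := lift (exist _ _ inc).
  exists (sval e'); first exact: (svalP e').
  by have /(congr1 sval) := liftK (exist _ _ inc).
(* The images of [e] and [e'] are edges at [onV m' v] of the same type, so the bijection in [Y]
   identifies them. *)
have ee' : e = e'.
  apply: string_mono_onE_inj.
  have bmv : is_box_vertex (onV m' v).
    by exists f; rewrite -tvE; apply: (onV_arr m').
  have inc : src (onE m' e) = onV m' v \/ tgt (onE m' e) = onV m' v.
    by rewrite onE_src onE_tgt; case: ev => ->; [left | right].
  have inc' : src (onE m' e') = onV m' v \/ tgt (onE m' e') = onV m' v.
    by rewrite mvv' onE_src onE_tgt; case: e'v' => ->; [left | right].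
  have /bij_inj tI := boxY _ bmv.
  have /(congr1 sval) // :
    exist _ (onE m' e) inc = exist _ (onE m' e') inc' :> incident (onV m' v).
  apply: tI; apply: eq_exist.
  by rewrite /=; have := onE_arr m' e; have := onE_arr m' e'; rewrite /typed_arr
    => -> ->; rewrite -/(typing _) tee'.
(* An edge meeting [v] and [v'] at the same end gives [v = v']; at opposite ends it would join two
   boxes. *)
subst e'; case: ev e'v' => [ev|ev] [ev'|ev']; rewrite -?ev -?ev' //.
  by case: (@no_box_box_edge e); rewrite ?ev ?ev'.
by case: (@no_box_box_edge e); rewrite ?ev ?ev'.
Qed.

End StringGraphMonos.

Theorem corollary5p1p9 (T : monoidal_signature) :
  partial_adhesive_via (SGraph_embedding T).
Proof.
split; last 2 first.
- exact: graph_slice_adhesive.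
- move=> X Y m mM; apply/mono_injective; split.
    exact: string_mono_onV_inj.
  exact: string_mono_onE_inj.
(* Homs are unchanged by the embedding; objects with the same underlying typed graph agree by proof
   irrelevance. *)
split; last by move=> X Y; exists id.
by move=> [X sX] [Y sY] /= eXY; apply: eq_exist.
Qed.
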